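(* The path $P_4$ is $C_5$-Tur\'an-good, i.e., $\mathrm{ex}(n,P_4,C_5)=\mathcal{N}(P_4,T_2(n))$ for all sufficiently large $n$. Moreover, if $G$ is a $C_5$-free graph on $n$ vertices in which exactly $\alpha$ edges are contained in triangles, then \[\mathcal{N}(P_4,G)\le \mathcal{N}(P_4,T_2(n))-(1+o(1))\,\alpha\,\frac{n^2}{12},\] where $o(1)$ denotes a quantity tending to $0$ as $n\to\infty$.
   Context: $P_4$ is the path on $4$ vertices and $C_5$ the cycle on $5$ vertices. A graph is $C_5$-free if it contains no $C_5$ as a subgraph. For graphs $H,G$, $\mathcal{N}(H,G)$ is the number of subgraphs of $G$ isomorphic to $H$; $\mathrm{ex}(n,H,F)$ is the maximum of $\mathcal{N}(H,G)$ over $n$-vertex graphs $G$ not containing $F$. $T_2(n)$ is the complete bipartite graph on $n$ vertices with class sizes $\lfloor n/2\rfloor$ and $\lceil n/2\rceil$. *)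

(* Defs.v *)
From HB Require Import structures.
From mathcomp Require Import all_boot.

Set Implicit Arguments.
Unset Strict Implicit.
Unset Printing Implicit Defensive.

Record sgraph (T : finType) := SGraph {
  edges : {set {set T}};
  edges_card2 : [forall e in edges, #|e| == 2]
}.

HB.instance Definition _ (T : finType) := [isSub for @edges T].
HB.instance Definition _ (T : finType) := [Finite of sgraph T by <:].

Section Graphs.
Variable T : finType.

Definition adj (G : sgraph T) (x y : T) : bool := [set x; y] \in edges G.

Lemma graph_of_subproof (r : rel T) :
  [forall e in [set e : {set T} | [exists x, exists y,
     [&& x != y, r x y & e == [set x; y]]]], #|e : {set T}| == 2].
Proof.
apply/forall_inP => e; rewrite inE => /existsP[x /existsP[y /and3P[xy _ /eqP->]]].
by rewrite cards2 xy.
Qed.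

(* The relation r need not be symmetric: x and y distinct are joined as soon
   as r x y or r y x holds. *)
Definition graph_of (r : rel T) : sgraph T := SGraph (graph_of_subproof r).

(* X = (W, F) is a subgraph of G, with vertex set W and edge set F. *)
Definition is_subgraph (X : {set T} * {set {set T}}) (G : sgraph T) : bool :=
  (X.2 \subset edges G) && [forall e in X.2, e \subset X.1].

Definition isomorphic (S : finType) (H : sgraph S)
    (X : {set T} * {set {set T}}) : bool :=
  [exists f : {ffun S -> T},
    [&& injectiveb f, X.1 == f @: [set: S]
      & X.2 == [set f @: (e : {set S}) | e in edges H]]].

Definition copies (S : finType) (H : sgraph S) (G : sgraph T) :
    {set {set T} * {set {set T}}} :=
  [set X | is_subgraph X G && isomorphic H X].

Definition num_copies (S : finType) (H : sgraph S) (G : sgraph T) : nat :=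
  #|copies H G|.

Definition free_of (S : finType) (F : sgraph S) (G : sgraph T) : bool :=
  copies F G == set0.

Definition triangle_edges (G : sgraph T) : {set {set T}} :=
  [set e in edges G | [exists x, exists y, exists z,
     [&& e == [set x; y], adj G x y, adj G y z & adj G x z]]].

End Graphs.

Definition ex_copies (n : nat) (S S' : finType) (H : sgraph S) (F : sgraph S') : nat :=
  \max_(G : sgraph 'I_n | free_of F G) num_copies H G.

Definition path_graph (n : nat) : sgraph 'I_n :=
  graph_of (fun i j : 'I_n => i.+1 == j).

(* The cycle on n vertices, meaningful for n >= 3. *)
Definition cycle_graph (n : nat) : sgraph 'I_n :=
  graph_of (fun i j : 'I_n => i.+1 %% n == j).

(* T_2(n): the classes are the vertices below floor(n/2) and the others. *)
Definition turan2 (n : nat) : sgraph 'I_n :=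
  graph_of (fun i j : 'I_n => (i < n./2) && (n./2 <= j)).

(* Main.v *)
Require Import Defs.
From mathcomp Require Import all_boot all_order all_algebra.
From mathcomp Require Import zify ring lra.
From mathcomp Require Import reals topology normedtype sequences.
Set Implicit Arguments.
Unset Strict Implicit.
Unset Printing Implicit Defensive.
Import Order.TTheory GRing.Theory Num.Theory.
Import numFieldNormedType.Exports.

(** Twice the number of copies of P_4 is at most the sum of (d x - 1) (d y - 1)
    over ordered edges xy, with equality in triangle-free graphs.  An edge in no
    triangle has d x + d y <= n, so its term is at most M, the value of all terms
    in T_2(n), with M about n^2 / 4.  It remains to see that an edge in a triangle
    contributes at most n^2 / 6 - n on average, and that G has at most n^2 / 4 edges;
    the latter follows once d x + d y is at most n on average over the triangle edges.

    Both averages use the local structure of a C_5-free graph.  If xy has k >= 3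
    common neighbours z, then the edges xz and yz lie in no other triangle and the
    neighbourhoods of the z's are disjoint from each other and from those of x and
    y, up to x and y themselves; so d x + d y + sum_z d z <= n + 3 k, which bounds
    the average over this book.  In a triangle whose edges all have at most 2 common
    neighbours, the degrees sum to at most n + 6. *)

(** * Arithmetic of balanced products *)

Lemma halfP m : exists k, (m./2 = k /\ m - m./2 = k /\ m = k + k) \/ (m./2 = k /\ m - m./2 = k.+1 /\ m = (k + k).+1).
Proof. by exists m./2; lia. Qed.

(** Two numbers of bounded sum have the largest product when they are balanced; positivity keeps the
    predecessors from truncating. *)
Lemma balanced_prod_max (a b m : nat) : 0 < a -> 0 < b -> a + b <= m ->
  a.-1 * b.-1 <= (m./2).-1 * (m - m./2).-1.
Proof.
case: a b => [|u] [|v] //= _ _ uv.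
have [k [|] [-> [-> mk]]] := halfP m.
  case: k mk => [|k] mk /=; first lia.
  have {}uv : u + v <= k + k by lia.
  have [] := leqP u k => uk; nia.
case: k mk => [|k] mk /=; first by rewrite mul0n; nia.
have {}uv : u + v <= k + k.+1 by lia.
have [] := leqP u k => uk; nia.
Qed.

(** The product of the two halves is the floor of [m ^ 2 / 4]. *)
Lemma half_prod_ge (E m : nat) : E.*2 * 2 <= m ^ 2 -> E <= m./2 * (m - m./2).
Proof.
have [k [|] [-> [-> ->]]] := halfP m; rewrite expnS expn1; nia.
Qed.

Lemma half_pred_prod_ge (m : nat) : m ^ 2 <= 4 * (m./2.-1 * (m - m./2).-1) + 4 * m.
Proof.
have [k [|] [-> [-> ->]]] := halfP m; rewrite expnS expn1; case: k => [|k] //=; nia.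
Qed.

(** * Neighbourhoods in $C_5$-free graphs *)

Section Relation.
Variables (T : finType) (e : rel T).
Hypotheses (esym : symmetric e) (eirr : irreflexive e).

Definition nbr (x : T) : {set T} := [set y | e x y].
Definition deg (x : T) : nat := #|nbr x|.
Definition codeg (x y : T) : nat := #|nbr x :&: nbr y|.
Definition c5_free := forall a b c d f : T, uniq [:: a; b; c; d; f] ->
  [&& e a b, e b c, e c d, e d f & e f a] -> False.

Lemma codegC x y : codeg x y = codeg y x.
Proof. by rewrite /codeg setIC. Qed.

Lemma edge_neq x y : e x y -> x != y.
Proof. by apply: contraTneq => ->; rewrite eirr. Qed.

Lemma codeg_gt0 x y z : e x z -> e y z -> 0 < codeg x y.
Proof. by move=> xz yz; apply/card_gt0P; exists z; rewrite !inE xz. Qed.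

Lemma codeg0_deg x y : codeg x y = 0 -> deg x + deg y <= #|T|.
Proof. by move=> c0; rewrite /deg -cardsUI [#|_ :&: _|]c0 addn0 max_card. Qed.

(** Inclusion-exclusion: the union has at most [#|T|] vertices and each of the three pairwise
    intersections at most 2. *)
Lemma light_deg x y z : codeg x y <= 2 -> codeg y z <= 2 -> codeg x z <= 2 ->
  deg x + deg y + deg z <= #|T| + 6.
Proof.
move=> xy yz xz.
have := cardsUI (nbr x) (nbr y); have := cardsUI (nbr x :|: nbr y) (nbr z).
have : #|nbr x :|: nbr y :|: nbr z| <= #|T| by exact: max_card.
have : #|(nbr x :|: nbr y) :&: nbr z| <= codeg x z + codeg y z.
  by rewrite setIUl cardsU leq_subr.
by move: xy yz xz; rewrite /deg /codeg; lia.
Qed.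

Lemma exists_third (Z : {set T}) a b : 3 <= #|Z| -> exists2 p, p \in Z & (p != a) && (p != b).
Proof.
move=> Z3; have : 0 < #|Z :\ a :\ b|.
  by move: Z3; rewrite (cardsD1 a Z) (cardsD1 b (Z :\ a)); lia.
by case/card_gt0P=> p; rewrite !inE => /and3P[pb pa pZ]; exists p; rewrite ?pa.
Qed.

Hypothesis free : c5_free.

(** Otherwise a third common neighbour [p] of [x] and [y], distinct from [z] and [w], closes the
    5-cycle [p y z w x]. *)
Lemma heavy_page x y z w : e x y -> 3 <= codeg x y -> e x z -> e y z ->
  e x w -> e z w -> w = y.
Proof.
move=> xy h xz yz xw zw; apply: contraTeq isT => wy.
have [p] := exists_third z w h; rewrite !inE => /andP[xp yp] /andP[pz pw].
case: (@free p y z w x); last by rewrite (esym p) yp yz zw (esym w) xw xp.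
rewrite /= !inE !negb_or pz pw (eq_sym y w) wy.
by rewrite !(eq_sym _ x) (eq_sym p y) !edge_neq.
Qed.

Lemma heavy_codeg x y z : e x y -> 3 <= codeg x y -> e x z -> e y z -> codeg x z = 1.
Proof.
move=> xy h xz yz; apply/eqP/cards1P; exists y; apply/setP=> w; rewrite !inE.
apply/andP/eqP => [[xw zw]|->]; first exact: (heavy_page xy h xz).
by rewrite xy esym.
Qed.

(** Distinct [z] and [z'] would give the 5-cycle [x z w z' y]. *)
Lemma heavy_page_disjoint x y z z' w : e x y -> e x z -> e y z -> e x z' -> e y z' ->
  e z w -> e z' w -> w != x -> w != y -> z = z'.
Proof.
move=> xy xz yz xz' yz' zw z'w wx wy; apply: contraTeq isT => zz'.
case: (@free x z w z' y); last by rewrite xz zw (esym w) z'w (esym z') yz' (esym y).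
rewrite /= !inE !negb_or zz' wy (eq_sym x w) wx (eq_sym w z').
by rewrite !(eq_sym _ y) (eq_sym y x) !edge_neq.
Qed.

(* The sets [nbr x :|: nbr y] and [nbr z :\: [set x; y]], for [z] a common
   neighbour of [x] and [y], are pairwise disjoint. *)
Lemma heavy_deg x y : e x y -> 3 <= codeg x y ->
  deg x + deg y + \sum_(z in nbr x :&: nbr y) deg z <= #|T| + 3 * codeg x y.
Proof.
move=> xy h; set Z := nbr x :&: nbr y.
have h' : 3 <= codeg y x by rewrite codegC.
have yx : e y x by rewrite esym.
(* Removing [x] and [y] from each [nbr z] costs 2 per common neighbour; the third unit in
   [3 * codeg x y] is the overlap of [nbr x] and [nbr y]. *)
have -> : \sum_(z in Z) deg z = \sum_(z in Z) (#|nbr z :\: [set x; y]| + 2).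
  apply: eq_bigr => z; rewrite !inE => /andP[xz yz].
  rewrite /deg -(cardsID [set x; y] (nbr z)) addnC; congr addn.
  rewrite (setIidPr _) ?cards2 ?edge_neq //.
  by apply/subsetP=> w; rewrite !inE => /orP[]/eqP->; rewrite esym.
rewrite big_split /= sum_nat_const.
(* Double counting: summed over [w] instead, disjointness says that [w] occurs for at most one [z],
   and for none if [w] is adjacent to [x] or [y]. *)
have -> : \sum_(z in Z) #|nbr z :\: [set x; y]|
    = \sum_w #|[set z in Z | w \in nbr z :\: [set x; y]]|.
  under eq_bigr do rewrite -sum1_card big_mkcond.
  rewrite exchange_big; apply: eq_bigr => w _.
  rewrite -sum1_card [in RHS](eq_bigl (fun z => (z \in Z) && (w \in nbr z :\: [set x; y]))).
    by rewrite [in RHS]big_mkcondr.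
  by move=> z; rewrite inE.
have : \sum_w #|[set z in Z | w \in nbr z :\: [set x; y]]| <= #|~: (nbr x :|: nbr y)|.
  rewrite -sum1_card [in leqRHS]big_mkcond; apply: leq_sum => w _.
  have [_|] := boolP (w \in ~: _).
    rewrite leqNgt; apply/negP => /card_gt1P[z [z' []]].
    rewrite !inE !negb_or => /and3P[/andP[xz yz] /andP[wx wy] zw].
    move=> /and3P[/andP[xz' yz'] _ z'w] /negP[]; apply/eqP.
    exact: (heavy_page_disjoint xy xz yz xz' yz' zw).
  rewrite !inE negbK => xyw; rewrite leqn0 cards_eq0; apply/eqP/setP => z.
  rewrite !inE; apply/negP; rewrite !negb_or => /and3P[/andP[xz yz] /andP[wx wy] zw].
  case/orP: xyw => [xw|yw].
    by move: wy; rewrite (heavy_page xy h xz yz xw zw) eqxx.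
  by move: wx; rewrite (heavy_page yx h' yz xz yw zw) eqxx.
have : #|nbr x :|: nbr y| + #|~: (nbr x :|: nbr y)| = #|T| by rewrite cardsC.
have := cardsUI (nbr x) (nbr y).
rewrite -!/(deg _) -/Z /codeg -/Z.
move: (\sum_w _)%N #|~: _| #|_ :|: _| #|Z| (deg x) (deg y) => a b c d f g.
by move: #|T| => n; lia.
Qed.

Lemma heavy_indep x y z w : e x y -> 3 <= codeg x y ->
  z \in nbr x :&: nbr y -> w \in nbr x :&: nbr y -> e z w = false.
Proof.
rewrite !inE => xy h /andP[xz yz] /andP[xw yw]; apply/negP => zw.
by move: yw; rewrite (heavy_page xy h xz yz xw zw) eirr.
Qed.

(** * Charging triangle edges to books and light triangles *)

Local Open Scope ring_scope.
Variable R : realFieldType.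

Definition tri x y z := [&& e x y, e y z & e x z].
(** Three common neighbours are what [heavy_page] needs: one besides [z] and [w]. *)
Definition heavy x y := (2 < codeg x y)%N.
Definition trip x y := e x y && (0 < codeg x y)%N.

(* The books with a heavy spine are edge-disjoint from each other and from the light
   triangles; in the latter an edge [xy] gets weight [3 - codeg x y = 2 / codeg x y],
   so that its weights over the triangles through it add up to 2. *)
Lemma charging (g : T -> T -> R) :
  (forall x y, g x y = g y x) ->
  (forall x y, e x y -> heavy x y ->
     0 <= g x y + \sum_(z in nbr x :&: nbr y) (g x z + g y z)) ->
  (forall x y z, tri x y z -> ~~ heavy x y -> ~~ heavy y z -> ~~ heavy x z ->
     0 <= (3 - (codeg x y)%:R) * g x y + (3 - (codeg y z)%:R) * g y z
        + (3 - (codeg x z)%:R) * g x z) ->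
  0 <= \sum_x \sum_(y | trip x y) g x y.
Proof.
move=> gC gheavy glight.
pose wt x y : R := (3 - (codeg x y)%:R) * g x y.
have wtC x y : wt x y = wt y x by rewrite /wt codegC gC.
have heavyC x y : heavy x y = heavy y x by rewrite /heavy codegC.
have tri_swap12 x y z : tri x y z = tri y x z.
  by rewrite /tri (esym y x); congr andb; rewrite andbC.
have tri_swap23 x y z : tri x y z = tri x z y.
  by rewrite /tri (esym z y); case: (e x y); case: (e y z); case: (e x z).
pose I (b : bool) : R := b%:R.
pose light x y z := [&& tri x y z, ~~ heavy x y, ~~ heavy y z & ~~ heavy x z].
(* [L] runs over light triangles, [H] over heavy spines, and [K] over the edges from a spine end [x]
   to a page [z]. *)
pose L := \sum_x \sum_y \sum_z I (light x y z) * wt x y.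
pose H := \sum_x \sum_y I (e x y && heavy x y) * g x y.
pose K := \sum_x \sum_y \sum_z I (tri x y z && heavy x y) * g x z.
(* Relabelling vertices turns [L] into the same sum of [wt y z] and of [wt x z]; adding the three,
   [glight] applies to each triangle. *)
have L_ge0 : 0 <= L.
  have L2 : L = \sum_x \sum_y \sum_z I (light x y z) * wt y z.
    rewrite /L exchange_big /=; under eq_bigr do rewrite exchange_big /=.
    rewrite exchange_big /=.
    apply: eq_bigr => x _; apply: eq_bigr => y _; apply: eq_bigr => z _.
    rewrite [wt z y]wtC; congr (I _ * _); rewrite /light.
    rewrite (tri_swap23 x y) (tri_swap12 x z) (tri_swap23 z x) (heavyC z y) (heavyC y x) (heavyC z x).
    by case: (heavy x y); case: (heavy y z); case: (heavy x z); rewrite /= ?andbF.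
  have L3 : L = \sum_x \sum_y \sum_z I (light x y z) * wt x z.
    rewrite /L; under eq_bigr do rewrite exchange_big /=.
    apply: eq_bigr => x _; apply: eq_bigr => y _; apply: eq_bigr => z _.
    congr (I _ * _); rewrite /light (tri_swap23 x y) (heavyC z y).
    by case: (heavy x y); case: (heavy y z); case: (heavy x z); rewrite /= ?andbF.
  have : 0 <= L + L + L.
    rewrite {2}L2 {2}L3 /L -!big_split /=; apply: sumr_ge0 => x _.
    rewrite -!big_split /=; apply: sumr_ge0 => y _.
    rewrite -!big_split /=; apply: sumr_ge0 => z _.
    rewrite -!mulrDr /I; case: (boolP (light x y z)) => [|_]; last by rewrite mul0r.
    by case/and4P=> t a b c; rewrite mul1r; exact: glight.
  lra.
have HK_ge0 : 0 <= H + (K + K).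
  have K2 : K = \sum_x \sum_y \sum_z I (tri x y z && heavy x y) * g y z.
    rewrite /K exchange_big; apply: eq_bigr => x _; apply: eq_bigr => y _.
    by apply: eq_bigr => z _; rewrite tri_swap12 heavyC.
  rewrite {2}K2 /H /K -!big_split; apply: sumr_ge0 => x _.
  rewrite -!big_split; apply: sumr_ge0 => y _ /=.
  rewrite -big_split /=.
  have [/andP[xy h]|n_xyh] := boolP (e x y && heavy x y); last first.
    rewrite mul0r add0r; apply: sumr_ge0 => z _.
    rewrite /tri; move: n_xyh; rewrite /I.
    by case: (e x y); case: (heavy x y); rewrite //= ?andbF !mul0r addr0.
  rewrite mul1r (le_trans (gheavy _ _ xy h)) // lerD2l.
  rewrite big_mkcond ler_sum // => z _; rewrite !inE /I /tri xy h andbT /= andbC.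
  by case: ifP => _; rewrite ?mul1r ?mul0r ?addr0.
have heavy_tri x y z : tri x y z -> heavy x y -> codeg x z = 1%N /\ codeg y z = 1%N.
  move=> /and3P[xy yz xz] h; split; first exact: (heavy_codeg xy h).
  by apply: (@heavy_codeg y x); rewrite ?(esym y x) // codegC.
(* A page edge occurs in both orders, hence [K] twice; the half on [L] cancels the total weight 2 of
   an edge. *)
suff -> : \sum_x \sum_(y | trip x y) g x y = H + (K + K) + L / 2 by lra.
have split_edge x y : I (trip x y) * g x y
    = I (e x y && heavy x y) * g x y
      + (\sum_z I (tri x y z && ~~ heavy x y) * wt x y) / 2.
  rewrite -mulr_suml.
  have -> : \sum_z I (tri x y z && ~~ heavy x y)
     = I (e x y && ~~ heavy x y) * (codeg x y)%:R.
    rewrite /codeg -sum1_card natr_sum mulr_sumr [RHS]big_mkcond; apply: eq_bigr => z _.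
    rewrite !inE /I /tri (andbC (e y z)) mulr1.
    by case: (e x y); case: (e x z); case: (e y z); case: (heavy x y); rewrite /= ?andbF.
  rewrite /trip /wt /heavy; case: (e x y); last by rewrite /I /=; lra.
  by case: (codeg x y) => [|[|[|k]]]; rewrite /I /=; lra.
(* A triangle on a non-heavy edge [xy] is light or has one heavy edge, [xz] or [yz]. In the latter
   case [codeg x y = 1], so [wt x y] is twice [g x y]. *)
have split_tri x y z : I (tri x y z && ~~ heavy x y) * wt x y
    = I (light x y z) * wt x y
      + (I (tri x z y && heavy x z) * g x y + I (tri y z x && heavy y z) * g y x)
      + (I (tri x z y && heavy x z) * g x y + I (tri y z x && heavy y z) * g y x).
  have t23 : tri x z y = tri x y z by rewrite tri_swap23.
  have t123 : tri y z x = tri x y z by rewrite tri_swap23 tri_swap12.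
  rewrite (gC y x) /light /I t23 t123.
  have [t|_] := boolP (tri x y z); last by rewrite /=; lra.
  rewrite t in t23 t123.
  have [hxy|nxy] /= := boolP (heavy x y).
    by have [cxz cyz] := heavy_tri _ _ _ t hxy; rewrite /heavy cxz cyz /=; lra.
  have [hyz|nyz] /= := boolP (heavy y z).
    have [cyx cxz] := heavy_tri _ _ _ t123 hyz.
    by rewrite /heavy (codegC x z) cxz /wt (codegC x y) cyx /=; lra.
  have [hxz|nxz] /= := boolP (heavy x z); last lra.
  have [cxy _] := heavy_tri _ _ _ t23 hxz.
  by rewrite /wt cxy; lra.
have K2 : K = \sum_x \sum_y \sum_z I (tri x z y && heavy x z) * g x y.
  by apply: eq_bigr => x _; rewrite exchange_big.
have K3 : K = \sum_x \sum_y \sum_z I (tri y z x && heavy y z) * g y x.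
  by rewrite K2 exchange_big.
transitivity (\sum_x \sum_y I (trip x y) * g x y).
  apply: eq_bigr => x _; rewrite big_mkcond; apply: eq_bigr => y _.
  by rewrite /I; case: ifP; rewrite ?mul1r ?mul0r.
rewrite {1}K2 K3 /H /L mulr_suml -!big_split /=; apply: eq_bigr => x _.
rewrite mulr_suml -!big_split /=; apply: eq_bigr => y _.
rewrite split_edge -addrA; congr (_ + _).
rewrite (eq_bigr _ (fun z _ => split_tri x y z)).
by rewrite !big_split /=; lra.
Qed.

(** * Degree averages and the total weight of the edges *)

Let n : R := #|T|%:R.
Let d (x : T) : R := (deg x)%:R.

Lemma deg_le x : d x <= n.
Proof. by rewrite ler_nat max_card. Qed.

Lemma sum_adj_l (f : T -> R) : \sum_x \sum_(y | e x y) f x = \sum_x d x * f x.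
Proof.
apply: eq_bigr => x _; rewrite sumr_const mulr_natl; congr (_ *+ _).
by apply: eq_card => y; rewrite !inE.
Qed.

Lemma sum_adj_r (f : T -> R) : \sum_x \sum_(y | e x y) f y = \sum_x d x * f x.
Proof.
rewrite (exchange_big_dep predT) //= -sum_adj_l; apply: eq_bigr => x _.
by apply: eq_bigl => y; rewrite esym.
Qed.

Lemma notrip_deg x y : e x y -> ~~ trip x y -> d x + d y <= n.
Proof.
by rewrite /trip => -> /=; rewrite -eqn0Ngt -natrD ler_nat => /eqP/codeg0_deg.
Qed.

(* Over all edges, [n - d x - d y] sums to [n * sum d x - 2 * sum d x ^+ 2];
   compare with [sum (d x - n / 2) ^+ 2 >= 0]. *)
Lemma degree_sum_le : 0 <= \sum_x \sum_(y | trip x y) (n - d x - d y) ->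
  \sum_x d x <= n ^+ 2 / 2.
Proof.
move=> trip_ge0.
have edge_ge0 : 0 <= \sum_x \sum_(y | e x y) (n - d x - d y).
  apply: le_trans trip_ge0 _; apply: ler_sum => x _.
  rewrite [leRHS](bigID (trip x)) /= [X in _ <= X + _](eq_bigl (trip x)).
    rewrite lerDl; apply: sumr_ge0 => y /andP[xy /(notrip_deg xy)]; lra.
  by move=> y; rewrite /trip; case: (e x y).
have : \sum_x \sum_(y | e x y) (n - d x - d y)
    = n * (\sum_x d x) - 2 * \sum_x d x * d x.
  under eq_bigr do rewrite !big_split /=.
  rewrite !big_split /= sum_adj_l (sum_adj_l (fun x => - d x)) (sum_adj_r (fun x => - d x)).
  have -> : \sum_x d x * - d x = - \sum_x d x * d x.
    by rewrite -sumrN; apply: eq_bigr => x _; rewrite mulrN.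
  by rewrite -mulr_suml; lra.
have : 0 <= \sum_x (d x - n / 2) ^+ 2 by apply: sumr_ge0 => x _; exact: sqr_ge0.
have -> : \sum_x (d x - n / 2) ^+ 2 = \sum_x d x * d x - n * (\sum_x d x) + n * (n ^+ 2 / 4).
  have -> : n * (n ^+ 2 / 4) = \sum_(x : T) n ^+ 2 / 4.
    by rewrite sumr_const mulr_natl.
  rewrite mulr_sumr -sumrB -big_split /=.
  by apply: eq_bigr => x _; field.
move=> sq_ge0 edge_eq; have n_ge0 : 0 <= n by rewrite ler0n.
have [n0|n_neq0] := eqVneq n 0.
  rewrite big1 ?n0; first by lra.
  move=> x _; apply/eqP; rewrite eq_le ler0n andbT.
  by have := deg_le x; rewrite n0.
have n_gt0 : 0 < n by rewrite lt_def n_neq0.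
rewrite -(ler_pM2l n_gt0); move: edge_ge0; rewrite edge_eq => edge_ge0; lra.
Qed.

(** This is the exceptional case of a book missing at most 4 vertices. Its pages are independent, so
    they have degree at most 4, and the degrees sum to at most [4 * n + 4 * n], which is at most
    [n ^+ 2 / 2] once [n >= 16]. *)
Lemma degree_sum_le_heavy x y : (16 <= #|T|)%N -> e x y -> heavy x y ->
  (#|T| < codeg x y + 5)%N -> \sum_z d z <= n ^+ 2 / 2.
Proof.
move=> n16 xy h big; set Z := nbr x :&: nbr y.
have card_Z : (#|Z| + #|~: Z| = #|T|)%N by rewrite cardsC.
have lenC : (#|~: Z| <= 4)%N by move: big card_Z; rewrite /codeg -/Z; lia.
have n_ge0 : 0 <= n by rewrite ler0n.
rewrite (bigID (mem Z)) /=.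
have : \sum_(z in Z) d z <= \sum_(z in Z) 4.
  apply: ler_sum => z zZ; rewrite ler_nat.
  apply: leq_trans lenC; apply: subset_leq_card; apply/subsetP => w.
  by rewrite [w \in nbr z]inE in_setC => zw; apply/negP => wZ; move: (heavy_indep xy h zZ wZ); rewrite zw.
have : \sum_(z | z \notin Z) d z <= \sum_(z in ~: Z) n.
  rewrite [leRHS](eq_bigl (fun z => z \notin Z)); first by apply: ler_sum => z _; exact: deg_le.
  by move=> z; rewrite inE.
rewrite !sumr_const.
have : 4 *+ #|Z| <= 4 * n by rewrite -[leLHS]mulr_natr ler_wpM2l // ler_nat max_card.
have : n *+ #|~: Z| <= n * 4 by rewrite -[leLHS]mulr_natr ler_wpM2l // ler_nat.
have : 16 <= n by rewrite ler_nat.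
rewrite -/Z; nra.
Qed.

Lemma light_weight x y z : e x z -> e y z -> ~~ heavy x y ->
  3 - (codeg x y)%:R = 1 :> R \/ 3 - (codeg x y)%:R = 2 :> R.
Proof.
move=> xz yz; rewrite -leqNgt => h; have := codeg_gt0 xz yz.
by move: h; case: (codeg x y) => [|[|[|]]] //= _ _; [right|left]; lra.
Qed.

Lemma trip_degree_sum : (200 <= #|T|)%N ->
  (forall x y, e x y -> heavy x y -> codeg x y + 5 <= #|T|)%N ->
  0 <= \sum_x \sum_(y | trip x y) (n - d x - d y).
Proof.
move=> n200 small; have n_ge : 200 <= n by rewrite ler_nat.
apply: charging => [x y|x y xy h|x y z /and3P[xy yz xz] hxy hyz hxz]; first by lra.
- rewrite (_ : \sum_(z in _) _ = (codeg x y)%:R * (2 * n - d x - d y)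
     - 2 * (\sum_(z in nbr x :&: nbr y) deg z)%N%:R); last first.
    rewrite natr_sum mulr_sumr mulr_natl -sumr_const -sumrB.
    by apply: eq_bigr => z _; rewrite /d; lra.
  have : d x + d y + (\sum_(z in nbr x :&: nbr y) deg z)%N%:R <= n + 3 * (codeg x y)%:R.
    by rewrite -!natrD -natrM -natrD ler_nat; exact: heavy_deg.
  have : (codeg x y)%:R + 5 <= n by rewrite -natrD ler_nat small.
  have : 3 <= (codeg x y)%:R :> R by rewrite ler_nat.
  have : d x + d y <= n + (codeg x y)%:R.
    by rewrite -!natrD ler_nat /deg -cardsUI leq_add2r max_card.
  move: ((\sum_(z in _) _)%N%:R) ((codeg x y)%:R) (d x) (d y) => S k a b s_le k3 kn sum_le.
  (* After [S] is replaced by its bound from [heavy_deg], the expression equals the sum of these two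
     products; the second one is where [codeg x y + 5 <= #|T|] enters. *)
  have : 0 <= (k - 1) * (n + k - a - b) by apply: mulr_ge0; lra.
  have : 0 <= k * (n - k - 5) by apply: mulr_ge0; lra.
  nra.
- have : d x + d y + d z <= n + 6 by rewrite -!natrD ler_nat light_deg // leqNgt.
  have [yx zx zy] : [/\ e y x, e z x & e z y] by rewrite !(esym z) (esym y).
  have := light_weight xy zy hxz; have := light_weight yx zx hyz.
  have := light_weight xz yz hxy.
  (* Each degree is subtracted with the weights of two of the three edges, at most the total weight
     [W] minus 1; so the sum is at least [W * n - (W - 1) * (n + 6)], with [W <= 6]. *)
  have := (ler0n R (deg x), ler0n R (deg y), ler0n R (deg z)); rewrite -!/(d _).
  by move=> [[a0 b0] c0] [] -> [] -> [] -> deg_sum; lra.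
Qed.

(** The value [n ^+ 2 / 6 - n] is the lower bound [n ^+ 2 / 4 - n] for [M] less the saving
    [n ^+ 2 / 12] per triangle edge. *)
Lemma trip_weight_sum : (200 <= #|T|)%N ->
  0 <= \sum_x \sum_(y | trip x y) (n ^+ 2 / 6 - n - d x * d y).
Proof.
move=> n200; have n_ge : 200 <= n by rewrite ler_nat.
apply: charging => [x y|x y xy h|x y z /and3P[xy yz xz] hxy hyz hxz]; first by lra.
- rewrite (_ : \sum_(z in _) _ = (codeg x y)%:R * (n ^+ 2 / 3 - 2 * n)
     - (d x + d y) * (\sum_(z in nbr x :&: nbr y) deg z)%N%:R); last first.
    rewrite natr_sum mulr_sumr mulr_natl -sumr_const -sumrB.
    by apply: eq_bigr => z _; rewrite /d; lra.
  have : d x + d y + (\sum_(z in nbr x :&: nbr y) deg z)%N%:R <= n + 3 * (codeg x y)%:R.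
    by rewrite -!natrD -natrM -natrD ler_nat; exact: heavy_deg.
  have : (codeg x y)%:R <= n by rewrite ler_nat max_card.
  have : 3 <= (codeg x y)%:R :> R by rewrite ler_nat.
  have := (ler0n R (deg x), ler0n R (deg y)); rewrite -!/(d _).
  move: ((\sum_(z in _) _)%N%:R) ((codeg x y)%:R) (d x) (d y) => S k a b [a0 b0] k3 kn sum_le.
  have s_le : (a + b) * S <= (a + b) * (n + 3 * k - (a + b)) by apply: ler_wpM2l; lra.
  (* With [N = n + 3 * k] and [s = a + b], the second square gives [a * b <= s ^+ 2 / 4] and the
     first [s * (N - s) + s ^+ 2 / 4 <= N ^+ 2 / 3]. The products below make [N ^+ 2 / 3] small
     against [(2 * k + 1) * (n ^+ 2 / 6 - n)]. *)
  have sq1 := sqr_ge0 (2 * (n + 3 * k) - 3 * (a + b)).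
  have sq2 := sqr_ge0 (a - b).
  have : 0 <= (n - k) * k by apply: mulr_ge0; lra.
  have : 0 <= (n - 200) * (n * (k - 3)) by rewrite !mulr_ge0 //; lra.
  have : 0 <= (n - 200) * (n * k) by rewrite !mulr_ge0 //; lra.
  nra.
- have : d x + d y + d z <= n + 6 by rewrite -!natrD ler_nat light_deg // leqNgt.
  have [yx zx zy] : [/\ e y x, e z x & e z y] by rewrite !(esym z) (esym y).
  have := light_weight xy zy hxz; have := light_weight yx zx hyz.
  have := light_weight xz yz hxy.
  have := (ler0n R (deg x), ler0n R (deg y), ler0n R (deg z)); rewrite -!/(d _).
  move: (d x) (d y) (d z) => a b c [[a0 b0] c0] p q r abc.
  (* The weighted products are bounded by a multiple of [(a + b + c) ^+ 2], which is at most
     [(n + 6) ^+ 2]; [n >= 200] absorbs the linear terms. *)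
  have ab := sqr_ge0 (a - b); have bc := sqr_ge0 (b - c); have ac := sqr_ge0 (a - c).
  have ab0 := mulr_ge0 a0 b0; have bc0 := mulr_ge0 b0 c0; have ac0 := mulr_ge0 a0 c0.
  have a2 := sqr_ge0 a; have b2 := sqr_ge0 b; have c2 := sqr_ge0 c.
  have : 0 <= (n + 6 - a - b - c) * (n + 6 + a + b + c) by apply: mulr_ge0; lra.
  have : 0 <= (n - 200) * n by apply: mulr_ge0; lra.
  by move: p q r => [] -> [] -> [] -> *; lra.
Qed.

Lemma degree_sum_le_large : (200 <= #|T|)%N -> \sum_x d x <= n ^+ 2 / 2.
Proof.
move=> n200.
have [/existsP[x /existsP[y /and3P[xy h big]]]|small] := boolP [exists x, exists y,
    [&& e x y, heavy x y & #|T| < codeg x y + 5]%N].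
  by apply: (degree_sum_le_heavy _ xy h big); apply: leq_trans n200.
apply/degree_sum_le/trip_degree_sum => // x y xy h; rewrite leqNgt; apply: contra small => big.
by apply/existsP; exists x; apply/existsP; exists y; rewrite xy h.
Qed.

Let M : nat := ((#|T|./2).-1 * (#|T| - #|T|./2).-1)%N.

Lemma notrip_weight x y : e x y -> ~~ trip x y -> ((deg x).-1 * (deg y).-1 <= M)%N.
Proof.
move=> xy ntri; apply: balanced_prod_max.
- by apply/card_gt0P; exists y; rewrite inE.
- by apply/card_gt0P; exists x; rewrite inE esym.
- by move: ntri; rewrite /trip xy -eqn0Ngt => /eqP/codeg0_deg.
Qed.

(** Without triangle edges both sides vanish. This alternative keeps small triangle-free graphs
    covered, where [alpha = 0] and no [eps] could help. *)
Lemma trip_weight_le : ((\sum_x #|[set y | trip x y]| == 0) || (200 <= #|T|))%N ->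
  (\sum_x \sum_(y | trip x y) (deg x).-1 * (deg y).-1)%N%:R
    <= (\sum_x #|[set y | trip x y]|)%N%:R * (n ^+ 2 / 6 - n).
Proof.
move=> hyp; have -> : (\sum_x #|[set y | trip x y]|)%N%:R * (n ^+ 2 / 6 - n)
     = \sum_x \sum_(y | trip x y) (n ^+ 2 / 6 - n).
  rewrite natr_sum mulr_suml; apply: eq_bigr => x _; rewrite sumr_const mulr_natl.
  by congr (_ *+ _); apply: eq_card => y; rewrite !inE.
rewrite natr_sum; case/orP: hyp => [|n200].
  rewrite sum_nat_eq0 => /forallP no; rewrite !big1 // => x _; [|rewrite natr_sum]; rewrite big1 // => y txy.
    by have := no x; rewrite /= cards_eq0 => /eqP/setP/(_ y); rewrite !inE txy.
  by have := no x; rewrite /= cards_eq0 => /eqP/setP/(_ y); rewrite !inE txy.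
rewrite -subr_ge0 -sumrB; apply: le_trans (trip_weight_sum n200) _.
apply: ler_sum => x _; rewrite natr_sum -sumrB; apply: ler_sum => y _.
by rewrite lerD2l lerN2 -natrM ler_nat leq_mul ?leq_pred.
Qed.

(** With [A] ordered triangle edges, the total is at most [(E.*2 - A) * M + A * (n ^+ 2 / 6 - n)];
    since [M >= n ^+ 2 / 4 - n], each triangle edge saves [n ^+ 2 / 12] against [M]. *)
Lemma edge_weight_le (E : nat) :
  ((\sum_x #|[set y | trip x y]| == 0) || (200 <= #|T|))%N ->
  (\sum_x deg x = E.*2)%N ->
  (\sum_x \sum_(y | e x y) (deg x).-1 * (deg y).-1)%N%:R
    <= (2 * (#|T|./2 * (#|T| - #|T|./2)) * M)%N%:R
       - (\sum_x #|[set y | trip x y]|)%N%:R * (n ^+ 2 / 12).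
Proof.
move=> hyp degE; set A := (\sum_x #|_|)%N.
have E_le : (E <= #|T|./2 * (#|T| - #|T|./2))%N.
  have : \sum_x d x <= n ^+ 2 / 2.
    case/orP: (hyp) => [|n200]; last exact: degree_sum_le_large.
    rewrite sum_nat_eq0 => /forallP no; apply: degree_sum_le; rewrite big1 // => x _.
    rewrite big1 // => y txy.
    by have := no x; rewrite /= cards_eq0 => /eqP/setP/(_ y); rewrite !inE txy.
  rewrite -natr_sum degE -natrX ler_pdivlMr // -natrM ler_nat.
  exact: half_prod_ge.
have notrip_count : (\sum_x #|[set y | e x y && ~~ trip x y]| + A = E.*2)%N.
  rewrite -degE -big_split /=; apply: eq_bigr => x _.
  rewrite addnC /deg -(cardsID [set y | trip x y] (nbr x)); congr (_ + _)%N; apply: eq_card => y.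
    by rewrite !inE /trip; case: (e x y).
  by rewrite !inE andbC.
have := trip_weight_le hyp; rewrite -/A.
have -> : (\sum_x \sum_(y | e x y) (deg x).-1 * (deg y).-1
    = \sum_x \sum_(y | trip x y) (deg x).-1 * (deg y).-1
      + \sum_x \sum_(y | e x y && ~~ trip x y) (deg x).-1 * (deg y).-1)%N.
  rewrite -big_split; apply: eq_bigr => x _ /=; rewrite (bigID (trip x)) /=; congr (_ + _)%N.
  by apply: eq_bigl => y; rewrite /trip; case: (e x y).
have : (\sum_x \sum_(y | e x y && ~~ trip x y) (deg x).-1 * (deg y).-1
    <= (E.*2 - A) * M)%N.
  rewrite -notrip_count addnK big_distrl; apply: leq_sum => x _ /=.
  rewrite -sum_nat_const [leqRHS](eq_bigl (fun y => e x y && ~~ trip x y)); last by move=> y; rewrite inE.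
  by apply: leq_sum => y /andP[]; exact: notrip_weight.
have M_ge : n ^+ 2 / 4 - n <= M%:R.
  have := half_pred_prod_ge #|T|; rewrite -/M -(ler_nat R) natrX natrD !natrM -/n; lra.
have A_le : (A <= E.*2)%N by rewrite -notrip_count leq_addl.
rewrite -(ler_nat R) natrM natrB // natrD => notrip_le trip_le.
have EM : (E.*2)%:R * M%:R <= (2 * (#|T|./2 * (#|T| - #|T|./2)) * M)%N%:R :> R.
  by rewrite -natrM ler_nat leq_mul // -mul2n leq_mul.
have AM : 0 <= A%:R * (M%:R - (n ^+ 2 / 4 - n)) by rewrite mulr_ge0 ?ler0n // subr_ge0.
lra.
Qed.

End Relation.

(** * Counting edges, triangle edges and paths in a graph *)

Lemma set2_eq (T : finType) (x y a b : T) :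
  [set x; y] = [set a; b] -> x = a /\ y = b \/ x = b /\ y = a.
Proof.
move=> /setP eq_xy; have := (eq_xy x, eq_xy y, eq_xy a, eq_xy b).
rewrite !inE !eqxx !orbT /= => -[[[]]].
move=> /esym/orP[]/eqP-> /esym/orP[]/eqP-> /orP[]/eqP Ha /orP[]/eqP Hb; subst; auto.
Qed.

Lemma imset2set (S T : finType) (f : S -> T) x y : f @: [set x; y] = [set f x; f y].
Proof. by rewrite imsetU !imset_set1. Qed.

Lemma card_pair_set (U V : finType) (A : {set U * V}) :
  #|A| = \sum_u #|[set v | (u, v) \in A]|.
Proof.
rewrite -sum1_card; under [RHS]eq_bigr do rewrite -sum1_card.
by rewrite pair_big_dep /=; apply: eq_bigl => -[u v] /=; rewrite inE.
Qed.

Lemma card_ordered_pairs (T : finType) (E : {set {set T}}) :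
  {in E, forall e, #|e : {set T}| = 2} ->
  \sum_x #|[set y | [set x; y] \in E]| = #|E|.*2.
Proof.
move=> E2; have -> : \sum_x #|[set y | [set x; y] \in E]|
    = #|[set p : T * T | [set p.1; p.2] \in E]|.
  by rewrite card_pair_set; apply: eq_bigr => x _; apply: eq_card => y; rewrite !inE.
rewrite -sum1_card (partition_big (fun p : T * T => [set p.1; p.2]) (mem E)) /=; last first.
  by move=> p; rewrite inE.
rewrite -muln2 -sum_nat_const; apply: eq_bigr => e eE.
have /eqP/cards2P[a [b [ab def_e]]] := E2 e eE.
rewrite sum1dep_card -(_ : #|[set (a, b); (b, a)]| = 2); last first.
  by rewrite cards2 xpair_eqE (negPf ab).
apply: eq_card => -[x y]; rewrite !inE /= !xpair_eqE.
apply/andP/orP => [[_ /eqP]|].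
  by rewrite def_e => /set2_eq[[-> ->]|[-> ->]]; rewrite !eqxx; [left|right].
by rewrite def_e in eE * => -[]/andP[/eqP-> /eqP->]; rewrite ?[[set b; a]]setUC eE eqxx.
Qed.

Section Graph.
Variables (T : finType) (G : sgraph T).

Lemma adj_sym : symmetric (adj G).
Proof. by move=> x y; rewrite /adj setUC. Qed.

Lemma card_edge e : e \in edges G -> #|e| = 2.
Proof. by move/(forall_inP (edges_card2 G))/eqP. Qed.

Lemma adj_irr : irreflexive (adj G).
Proof. by move=> x; apply/negP => /card_edge; rewrite setUid cards1. Qed.

Lemma sum_deg : \sum_x deg (adj G) x = #|edges G|.*2.
Proof.
rewrite -card_ordered_pairs; first by apply: eq_bigr => x _; apply: eq_card => y; rewrite !inE.
by move=> e; exact: card_edge.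
Qed.

Lemma sum_trip : \sum_x #|[set y | trip (adj G) x y]| = #|triangle_edges G|.*2.
Proof.
rewrite -card_ordered_pairs; last by move=> e; rewrite inE => /andP[/card_edge].
apply: eq_bigr => x _; apply: eq_card => y; rewrite !inE /trip -/(adj G x y).
apply: andb_id2l => xy; apply/card_gt0P/existsP => [[z]|[a /existsP[b /existsP[z]]]].
  rewrite !inE => /andP[xz yz]; exists x; apply/existsP; exists y; apply/existsP; exists z.
  by rewrite eqxx xy xz yz.
case/and4P => /eqP/set2_eq eq_xy _ bz az.
by exists z; rewrite !inE; case: eq_xy => -[-> ->]; rewrite ?az ?bz.
Qed.

Lemma free_cycle5 : free_of (cycle_graph 5) G -> c5_free (adj G).
Proof.
move=> /eqP free a b c d f Uabc /and5P[ab bc cd df fa].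
pose s := [:: a; b; c; d; f].
pose g : {ffun 'I_5 -> T} := [ffun i : 'I_5 => nth a s i].
pose X := (g @: [set: 'I_5], [set g @: (e : {set 'I_5}) | e in edges (cycle_graph 5)]).
suff : X \in copies (cycle_graph 5) G by rewrite free inE.
rewrite inE; apply/andP; split; last first.
  apply/existsP; exists g; rewrite !eqxx !andbT; apply/injectiveP => i j.
  by rewrite !ffunE => /eqP; rewrite nth_uniq //= => /eqP/val_inj.
apply/andP; split; last first.
  by apply/forall_inP => _ /imsetP[e _ ->]; apply/imsetS/subsetT.
apply/subsetP => _ /imsetP[e + ->]; rewrite inE => /existsP[i /existsP[j /and3P[_ ij /eqP->]]].
rewrite imset2set !ffunE -/(adj G _ _) -(eqP ij).
by case: i {ij} => [[|[|[|[|[|]]]]]].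
Qed.

Lemma copies_cycle5 : ~~ free_of (cycle_graph 5) G ->
  exists g : 'I_5 -> T, forall i : 'I_5, adj G (g i) (g (ordS i)).
Proof.
case/set0Pn => X; rewrite inE => /andP[/andP[/subsetP sub _] /existsP[g /and3P[_ _ /eqP def]]].
exists g => i; rewrite /adj -imset2set; apply: sub; rewrite def; apply: imset_f.
rewrite inE; apply/existsP; exists i; apply/existsP; exists (ordS i).
by rewrite eqxx andbT; case: i => [[|[|[|[|[|]]]]]].
Qed.

(* A path [a b c d] is stored with its middle edge first. *)
Definition path_copy (p : (T * T) * (T * T)) : {set T} * {set {set T}} :=
  let: ((b, c), (a, d)) := p in
  ([set a; b; c; d], [set [set a; b]; [set b; c]; [set c; d]]).

Definition paths : {set (T * T) * (T * T)} :=
  [set p | let: ((b, c), (a, d)) := p in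
     [&& adj G a b, adj G b c, adj G c d & uniq [:: a; b; c; d]]].

(** Matching the three edges in all possible ways, distinctness of the vertices leaves only the
    identity and the reversal. *)
Lemma path_copy_eq a b c d a' b' c' d' :
  uniq [:: a; b; c; d] -> uniq [:: a'; b'; c'; d'] ->
  path_copy ((b', c'), (a', d')) = path_copy ((b, c), (a, d)) ->
  [/\ a' = a, b' = b, c' = c & d' = d] \/ [/\ a' = d, b' = c, c' = b & d' = a].
Proof.
rewrite /= !inE !negb_or !andbT.
move=> /and3P[/and3P[/eqP ab /eqP ac /eqP ad] /andP[/eqP bc /eqP bd] /eqP cd].
move=> /and3P[/and3P[/eqP ab' /eqP ac' /eqP ad'] /andP[/eqP bc' /eqP bd'] /eqP cd'].
case=> _ /setP eq_edges.
have := (eq_edges [set a'; b'], eq_edges [set b'; c'], eq_edges [set c'; d']).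
rewrite !inE !eqxx !orbT /= -!orbA => -[[/esym/or3P e1 /esym/or3P e2] /esym/or3P e3].
case: e1 => /eqP/set2_eq[] [? ?]; case: e2 => /eqP/set2_eq[] [? ?];
  case: e3 => /eqP/set2_eq[] [? ?];
  first [exfalso; congruence | left; split; congruence | right; split; congruence].
Qed.

Lemma copies_path4 : copies (path_graph 4) G = path_copy @: paths.
Proof.
pose o0 : 'I_4 := @Ordinal 4 0 isT; pose o1 : 'I_4 := @Ordinal 4 1 isT.
pose o2 : 'I_4 := @Ordinal 4 2 isT; pose o3 : 'I_4 := @Ordinal 4 3 isT.
have ordE (i : 'I_4) : [\/ i = o0, i = o1, i = o2 | i = o3].
  by case: i => [[|[|[|[|]]]] lti] //; [constructor 1|constructor 2|constructor 3|constructor 4];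
    apply: val_inj.
have edgesE : edges (path_graph 4) = [set [set o0; o1]; [set o1; o2]; [set o2; o3]].
  apply/setP => e; rewrite !inE; apply/existsP/idP => [[i /existsP[j /and3P[_ ij /eqP->]]]|].
    by case: (ordE i) ij => ->; case: (ordE j) => -> // _; rewrite eqxx ?orbT.
  rewrite -orbA => /or3P[]/eqP->; [exists o0|exists o1|exists o2]; apply/existsP;
    [exists o1|exists o2|exists o3]; exact: eqxx.
have copyE (f : {ffun 'I_4 -> T}) :
    (f @: [set: 'I_4], [set f @: (e : {set 'I_4}) | e in edges (path_graph 4)])
    = path_copy ((f o1, f o2), (f o0, f o3)).
  congr pair; last first.
    by rewrite edgesE !(imsetU, imset_set1).
  rewrite (_ : [set: 'I_4] = [set o0; o1; o2; o3]) ?imsetU ?imset_set1 //.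
  by apply/setP => i; rewrite !inE; case: (ordE i) => ->.
have uniqE (f : {ffun 'I_4 -> T}) : injective f <-> uniq [:: f o0; f o1; f o2; f o3].
  split=> [injf|].
    by rewrite /= !inE !(inj_eq injf).
  rewrite /= !inE !negb_or !andbT => /and3P[/and3P[/eqP ? /eqP ? /eqP ?] /andP[/eqP ? /eqP ?] /eqP ?].
  by move=> i j; case: (ordE i) => ->; case: (ordE j) => -> //; congruence.
apply/setP => X; rewrite inE; apply/andP/imsetP.
  move=> [/andP[/subsetP sub _] /existsP[f /and3P[/injectiveP/uniqE Uf /eqP X1 /eqP X2]]].
  have defX : X = path_copy ((f o1, f o2), (f o0, f o3)).
    by rewrite -copyE -X1 -X2; case: (X).
  exists ((f o1, f o2), (f o0, f o3)) => //; rewrite inE Uf andbT.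
  by rewrite /adj !sub // defX !inE eqxx ?orbT.
move=> [[[b c] [a d]]]; rewrite inE => /and4P[ab bc cd Uabcd ->].
pose f : {ffun 'I_4 -> T} := [ffun i : 'I_4 => nth a [:: a; b; c; d] i].
have defX : path_copy ((b, c), (a, d)) = path_copy ((f o1, f o2), (f o0, f o3)).
  by rewrite !ffunE.
split; last first.
  apply/existsP; exists f; rewrite defX -copyE !eqxx !andbT; apply/injectiveP/uniqE.
  by rewrite !ffunE.
apply/andP; split; first by apply/subsetP => e; rewrite !inE -orbA => /or3P[]/eqP->.
apply/forall_inP => e; rewrite !inE -orbA => /or3P[]/eqP->;
  by apply/subsetP => z; rewrite !inE => /orP[] ->; rewrite ?orbT.
Qed.

(** Each fibre of [path_copy] on [paths] is a path and its reversal, which differ because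
    [b != c]. *)
Lemma card_paths : #|paths| = (num_copies (path_graph 4) G).*2.
Proof.
rewrite /num_copies copies_path4 -sum1_card (partition_big_imset path_copy) /=.
rewrite -muln2 -sum_nat_const; apply: eq_bigr => _ /imsetP[[[b c] [a d]] pP ->].
move: (pP); rewrite inE => /and4P[ab bc cd Up].
have neq_bc : b != c by apply: edge_neq bc; exact: adj_irr.
rewrite sum1dep_card -(_ : #|[set ((b, c), (a, d)); ((c, b), (d, a))]| = 2); last first.
  by rewrite cards2 !xpair_eqE (negPf neq_bc).
apply: eq_card => -[[b' c'] [a' d']]; rewrite in_set [RHS]in_set2 /=.
apply/andP/orP.
  rewrite inE => -[/and4P[_ _ _ Uq] /eqP/(path_copy_eq Up Uq)].
  by case=> -[-> -> -> ->]; rewrite eqxx; [left|right].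
case=> /eqP[-> -> -> ->]; first by rewrite pP eqxx.
split.
  have := Up; rewrite -rev_uniq inE => -> /=.
  by rewrite (adj_sym d c) (adj_sym c b) (adj_sym b a) ab bc cd.
rewrite /= xpair_eqE; apply/andP; split; apply/eqP/setP => z; rewrite !inE.
  by case: (z == a); case: (z == b); case: (z == c); case: (z == d).
rewrite (setUC [set d] [set c]) (setUC [set c] [set b]) (setUC [set b] [set a]).
by case: (z == [set a; b]); case: (z == [set b; c]); case: (z == [set c; d]).
Qed.

Lemma card_paths_sum : #|paths| = \sum_b \sum_(c | adj G b c)
  #|[set q in setX (nbr (adj G) b :\ c) (nbr (adj G) c :\ b) | q.1 != q.2]|.
Proof.
transitivity (\sum_b \sum_c #|[set v | ((b, c), v) \in paths]|).
  by rewrite card_pair_set pair_bigA; apply: eq_bigr => -[b c].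
apply: eq_bigr => b _; rewrite [RHS]big_mkcond; apply: eq_bigr => c _.
case: ifP => bc; last first.
  by apply: eq_card0 => -[a d]; rewrite !inE bc /= andbF.
have := edge_neq adj_irr bc => /negPf neq_bc.
apply: eq_card => -[a d]; rewrite !inE /= !inE bc (adj_sym a) neq_bc /=.
rewrite !negb_or (eq_sym b d).
have [ba|] := boolP (adj G b a); rewrite ?andbF //=.
have [cd|] := boolP (adj G c d); rewrite ?andbF //=.
have := (edge_neq adj_irr ba, edge_neq adj_irr cd); rewrite (eq_sym b) => -[-> ->].
by case: (a == c); case: (d == b); case: (a == d).
Qed.

Lemma card_paths_le :
  #|paths| <= \sum_b \sum_(c | adj G b c) (deg (adj G) b).-1 * (deg (adj G) c).-1.
Proof.
rewrite card_paths_sum; apply: leq_sum => b _; apply: leq_sum => c bc.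
apply: (@leq_trans #|setX (nbr (adj G) b :\ c) (nbr (adj G) c :\ b)|).
  by apply: subset_leq_card; apply/subsetP => q; rewrite inE => /andP[].
rewrite cardsX /deg (cardsD1 c (nbr _ b)) (cardsD1 b (nbr _ c)) !inE.
by rewrite (adj_sym c b) bc.
Qed.

(** Coinciding ends [a = d] would be a common neighbour of [b] and [c], so the condition
    [q.1 != q.2] is automatic. *)
Lemma card_paths_triangle_free : (forall x y, adj G x y -> codeg (adj G) x y = 0) ->
  #|paths| = \sum_b \sum_(c | adj G b c) (deg (adj G) b).-1 * (deg (adj G) c).-1.
Proof.
move=> no_tri.
rewrite card_paths_sum; apply: eq_bigr => b _; apply: eq_bigr => c bc.
transitivity #|setX (nbr (adj G) b :\ c) (nbr (adj G) c :\ b)|.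
  apply: eq_card => -[a d]; rewrite inE andb_idr // !inE /= => /andP[/andP[_ ba] /andP[_ cd]].
  apply/eqP => ad; have /eqP := no_tri _ _ bc; rewrite cards_eq0 => /eqP/setP/(_ a).
  by rewrite !inE ba ad cd.
rewrite cardsX /deg (cardsD1 c (nbr _ b)) (cardsD1 b (nbr _ c)) !inE.
by rewrite (adj_sym c b) bc.
Qed.

End Graph.

(** * The balanced complete bipartite graph *)

Section Turan.
Variable n : nat.
Let h := n./2.
Let G := turan2 n.

Lemma adj_turan (i j : 'I_n) : adj G i j = ((i < h) != (j < h)).
Proof.
rewrite /adj inE; apply/existsP/idP.
  case=> a /existsP[b /and3P[_ /andP[ah hb] /eqP/set2_eq]].
  by case=> -[-> ->]; rewrite ah ltnNge hb.
move=> ij; have neq : i != j by apply: contraNneq ij => ->.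
have [ih|hi] := ltnP i h.
  exists i; apply/existsP; exists j; rewrite neq ih eqxx andbT /=.
  by rewrite leqNgt -/h; move: ij; rewrite ih; case: (j < h).
exists j; apply/existsP; exists i; rewrite eq_sym neq hi setUC eqxx !andbT /=.
by move: ij; rewrite ltnNge hi /=; case: (j < h).
Qed.

Lemma codeg_turan (i j : 'I_n) : adj G i j -> codeg (adj G) i j = 0.
Proof.
rewrite adj_turan => ij; apply: eq_card0 => k; rewrite !inE !adj_turan.
by move: ij; case: (i < h); case: (j < h); case: (k < h).
Qed.

Lemma card_low : #|[set j : 'I_n | j < h]| = h.
Proof.
rewrite -sum1dep_card -(big_ord_widen n (fun=> 1)) ?sum1_card ?card_ord //.
by rewrite /h; lia.
Qed.

Lemma card_high : #|~: [set j : 'I_n | j < h]| = n - h.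
Proof.
apply/eqP; rewrite -(eqn_add2l h) -{1}card_low cardsC card_ord subnKC //.
by rewrite /h; lia.
Qed.

Lemma deg_turan (i : 'I_n) : deg (adj G) i = if i < h then n - h else h.
Proof.
have [ih|hi] := ltnP i h; last first.
  rewrite -[RHS]card_low; apply: eq_card => j; rewrite !inE adj_turan (ltnNge i) hi.
  by case: (j < h).
by rewrite -card_high; apply: eq_card => j; rewrite !inE adj_turan ih; case: (j < h).
Qed.

Lemma sum_deg_turan : \sum_i deg (adj G) i = 2 * (h * (n - h)).
Proof.
rewrite (bigID (fun i : 'I_n => i < h)) /=.
rewrite (eq_bigr (fun=> n - h)); last by move=> i ih; rewrite deg_turan ih.
rewrite [X in _ + X](eq_bigr (fun=> h)); last by move=> i /negPf ih; rewrite deg_turan ih.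
rewrite !sum_nat_const (eq_card (_ : _ =i [set j : 'I_n | j < h])); last by move=> j; rewrite inE.
rewrite card_low (eq_card (_ : _ =i ~: [set j : 'I_n | j < h])); last by move=> j; rewrite !inE.
by rewrite card_high mul2n -addnn (mulnC (n - h)).
Qed.

Lemma num_copies_turan :
  (num_copies (path_graph 4) G).*2 = 2 * (h * (n - h)) * (h.-1 * (n - h).-1).
Proof.
rewrite -card_paths card_paths_triangle_free; last exact: codeg_turan.
rewrite -sum_deg_turan big_distrl; apply: eq_bigr => b _ /=.
rewrite -sum_nat_const [RHS](eq_bigl (adj G b)); last by move=> c; rewrite inE.
apply: eq_bigr => c; rewrite adj_turan !deg_turan.
by case: (b < h); case: (c < h) => // _; rewrite mulnC.
Qed.

(** Along the closed walk from [copies_cycle5] the class would change at each of five steps, an odd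
    number. *)
Lemma free_turan : free_of (cycle_graph 5) G.
Proof.
apply/negPn/negP => /copies_cycle5[g adj_g].
have := (adj_g (@Ordinal 5 0 isT), adj_g (@Ordinal 5 1 isT), adj_g (@Ordinal 5 2 isT),
  adj_g (@Ordinal 5 3 isT), adj_g (@Ordinal 5 4 isT)).
have o i (i5 : i < 5) : ordS (Ordinal i5) = Ordinal (ltn_pmod i.+1 (isT : 0 < 5)) by exact: val_inj.
rewrite !o !adj_turan; pose s k := g (Ordinal (ltn_pmod k (isT : 0 < 5))) < h.
have sE k (k5 : k < 5) : (g (Ordinal k5) < h) = s k.
  by rewrite /s; congr (g _ < h); apply: val_inj; rewrite /= modn_small.
rewrite !sE /=; case: (s 0); case: (s 1); case: (s 2); case: (s 3); case: (s 4) => //= -[[[[]]]] //.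
Qed.
End Turan.

(** * The bound on copies of $P_4$ and the choice of the error term *)

Local Open Scope classical_set_scope.
Local Open Scope ring_scope.

Lemma num_copies_path4_le (R : realFieldType) (T : finType) (G : sgraph T) :
  free_of (cycle_graph 5) G ->
  (#|triangle_edges G| == 0)%N || (200 <= #|T|)%N ->
  (num_copies (path_graph 4) G)%:R
    <= (num_copies (path_graph 4) (turan2 #|T|))%:R
       - #|triangle_edges G|%:R * (#|T|%:R ^+ 2 / 12) :> R.
Proof.
move=> /free_cycle5 free hyp.
have hyp2 : ((\sum_x #|[set y | trip (adj G) x y]| == 0) || (200 <= #|T|))%N.
  by rewrite sum_trip double_eq0.
have := edge_weight_le (@adj_sym _ G) (@adj_irr _ G) free R hyp2 (sum_deg G).
have := card_paths_le G; rewrite -(ler_nat R) card_paths -num_copies_turan sum_trip.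
rewrite -!mul2n !natrM; lra.
Qed.

Lemma num_copies_path4_le_exp (T : finType) (G : sgraph T) :
  (num_copies (path_graph 4) G <= #|T| ^ 4)%N.
Proof.
apply: (@leq_trans #|paths G|); first by rewrite card_paths -addnn leq_addr.
apply: leq_trans (max_card _) _; rewrite !card_prod !expnS expn0 muln1.
by rewrite !mulnA.
Qed.

Theorem theorem14 (R : realType) :
  (exists n0 : nat, forall n : nat, (n0 <= n)%N ->
     ex_copies n (path_graph 4) (cycle_graph 5)
       = num_copies (path_graph 4) (turan2 n)) /\
  (exists2 eps : nat -> R, eps n @[n --> \oo] --> (0 : R) &
     forall (n alpha : nat) (T : finType) (G : sgraph T),
       #|T| = n ->
       free_of (cycle_graph 5) G ->
       #|triangle_edges G| = alpha ->
       (num_copies (path_graph 4) G)%:R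
         <= (num_copies (path_graph 4) (turan2 n))%:R
            - (1 + eps n) * alpha%:R * (n%:R ^+ 2 / 12%:R) :> R).
Proof.
split.
  exists 200%N => n n200; apply/eqP; rewrite eqn_leq; apply/andP; split.
    apply/bigmax_leqP => G free; rewrite -(ler_nat R).
    have := @num_copies_path4_le R _ G free; rewrite card_ord n200 orbT => /(_ isT).
    move=> /le_trans; apply; rewrite gerDl oppr_le0.
    by rewrite mulr_ge0 ?divr_ge0 ?exprn_ge0 ?ler0n.
  by rewrite /ex_copies; apply: (bigop.bigmax_sup (turan2 n)) => //; exact: free_turan.
(* Below 200 the factor [- (1 + eps n)] is [12 * n ^+ 4]. With [alpha >= 1] and [n >= 1] the right
   side then exceeds the trivial bound [n ^+ 4] on the number of copies. *)
exists (fun n => if (200 <= n)%N then 0 else - (12 * n%:R ^+ 4 + 1)).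
  by apply: cvg_near_cst; exists 200%N => // n /= ->.
move=> n alpha T G <- free <-.
have [n200|small] := boolP (200 <= #|T|)%N.
  have := @num_copies_path4_le R _ G free; rewrite n200 orbT addr0 mul1r => /(_ isT).
  by rewrite mulrA.
have [a0|a_neq0] := eqVneq #|triangle_edges G| 0%N.
  have := @num_copies_path4_le R _ G free; rewrite a0 eqxx => /(_ isT).
  by rewrite mulr0 !mul0r.
set a : R := #|triangle_edges G|%:R.
have a_ge1 : 1 <= a by rewrite ler1n lt0n.
have n_ge1 : 1 <= #|T|%:R :> R.
  rewrite ler1n lt0n; apply: contra a_neq0 => /eqP T0.
  rewrite cards_eq0; apply/eqP/setP => e; rewrite inE [RHS]inE; apply/negP => /andP[_ /existsP[x _]].
  by have := card0_eq T0 x; rewrite inE.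
have := num_copies_path4_le_exp G; rewrite -(ler_nat R) natrX => /le_trans; apply.
have : 0 <= (num_copies (path_graph 4) (turan2 #|T|))%:R :> R by rewrite ler0n.
move: n_ge1; set m : R := #|T|%:R => m_ge1.
have m4_ge0 : 0 <= m ^+ 4 by rewrite exprn_ge0 // (le_trans ler01).
have : m ^+ 4 * 1 <= m ^+ 4 * (a * m ^+ 2).
  by rewrite ler_wpM2l // -[leLHS]mulr1 ler_pM // exprn_ege1.
lra.
Qed.
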